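(* Let $\mathrm{Vect}$ be the category of vector spaces over $\mathbb F_2$, let $\mathrm{Vect}^2$ be the category of pairs of vector spaces over $\mathbb F_2$, and let $t:\mathrm{Ab}\to\mathrm{Vect}^2$ be the functor $t(A)=(A/2,{}_2A)$ on the category $\mathrm{Ab}$ of abelian groups. Assume that $n\geq2$. Then there is no functor $\Phi:\mathrm{Vect}^2\to\mathrm{Vect}$ such that there is a natural isomorphism of functors $\Phi\circ t\cong H_n(-,\mathbb F_2)$ on $\mathrm{Ab}$. Moreover, there is no such functor even if one restricts to the category of finitely generated abelian groups and the category of finite dimensional vector spaces; that is, there is no functor $\Phi$ from pairs of finite dimensional $\mathbb F_2$-vector spaces to finite dimensional $\mathbb F_2$-vector spaces such that $\Phi\circ t\cong H_n(-,\mathbb F_2)$ as functors on finitely generated abelian groups.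
   Context: $A/2=A/2A$ and ${}_2A=\{a\in A\mid 2a=0\}$. $H_n(-,\mathbb F_2)$ is the $n$-th group homology functor with coefficients in $\mathbb F_2$. $\mathrm{Vect}^2=\mathrm{Vect}\times\mathrm{Vect}$: a morphism of pairs is a pair of linear maps. Functors $\Phi$ are not assumed additive. *)

(* Defs.v *)
From HB Require Import structures.
From mathcomp Require Import all_boot all_order all_algebra.
From mathcomp Require Import ring_quotient boolp.
From mathcomp Require Import finmap monalg zify.

Set Implicit Arguments.
Unset Strict Implicit.
Unset Printing Implicit Defensive.

Import Order.TTheory GRing.Theory Num.Theory.
Local Open Scope fset_scope.
Local Open Scope ring_scope.
Local Open Scope quotient_scope.

Local Obligation Tactic := idtac.

Record category := Category {
  obj :> Type;
  hom : obj -> obj -> Type;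
  idm : forall A, hom A A;
  compm : forall A B C, hom B C -> hom A B -> hom A C;
  comp1m : forall A B (f : hom A B), compm (idm B) f = f;
  compm1 : forall A B (f : hom A B), compm f (idm A) = f;
  compmA : forall A B C D (h : hom C D) (g : hom B C) (f : hom A B),
    compm h (compm g f) = compm (compm h g) f
}.
Arguments idm {c} A.
Arguments compm {c A B C} g f.

Definition is_iso (C : category) (A B : C) (f : hom A B) :=
  exists g : hom B A, compm g f = idm A /\ compm f g = idm B.

Record functor (C D : category) := Functor {
  fobj :> C -> D;
  fmor : forall A B, hom A B -> hom (fobj A) (fobj B);
  fmor_id : forall A, fmor (idm A) = idm (fobj A);
  fmor_comp : forall A B E (g : hom B E) (f : hom A B),
    fmor (compm g f) = compm (fmor g) (fmor f)
}.
Arguments fmor {C D} F {A B} f : rename.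

Program Definition functor_comp (C D E : category)
    (G : functor D E) (F : functor C D) : functor C E :=
  {| fobj := fun A => G (F A);
     fmor := fun A B f => fmor G (fmor F f) |}.
Next Obligation. by move=> * /=; rewrite !fmor_id. Qed.
Next Obligation. by move=> * /=; rewrite !fmor_comp. Qed.

Definition nat_iso (C D : category) (F G : functor C D) :=
  exists eta : forall A, hom (F A) (G A),
    (forall A B (f : hom A B),
        compm (eta B) (fmor F f) = compm (fmor G f) (eta A)) /\
    (forall A, is_iso (eta A)).

Program Definition prod_category (C D : category) : category :=
  {| obj := (C * D)%type;
     hom := fun A B => (hom A.1 B.1 * hom A.2 B.2)%type;
     idm := fun A => (idm A.1, idm A.2);
     compm := fun A B E g f => (compm g.1 f.1, compm g.2 f.2) |}.
Next Obligation. by move=> C D A B [f g] /=; rewrite !comp1m. Qed.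
Next Obligation. by move=> C D A B [f g] /=; rewrite !compm1. Qed.
Next Obligation. by move=> * /=; rewrite !compmA. Qed.

Program Definition functor_pair (C D E : category)
    (F : functor C D) (G : functor C E) : functor C (prod_category D E) :=
  {| fobj := fun A => (F A, G A) : prod_category D E;
     fmor := fun A B f => (fmor F f, fmor G f) |}.
Next Obligation. by move=> * /=; rewrite !fmor_id. Qed.
Next Obligation. by move=> * /=; rewrite !fmor_comp. Qed.

Program Definition full_subcategory (C : category) (P : C -> Prop) : category :=
  {| obj := {A : C | P A};
     hom := fun A B => hom (sval A) (sval B);
     idm := fun A => idm (sval A);
     compm := fun A B E g f => compm g f |}.
Next Obligation. by move=> * /=; rewrite comp1m. Qed.
Next Obligation. by move=> * /=; rewrite compm1. Qed.
Next Obligation. by move=> * /=; rewrite compmA. Qed.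

Program Definition inclusion (C : category) (P : C -> Prop) :
    functor (full_subcategory P) C :=
  {| fobj := fun A => sval A; fmor := fun A B f => f |}.
Next Obligation. by []. Qed.
Next Obligation. by []. Qed.

Program Definition restriction (C D : category) (P : C -> Prop) (Q : D -> Prop)
    (F : functor C D) (PQ : forall A, P A -> Q (F A)) :
    functor (full_subcategory P) (full_subcategory Q) :=
  {| fobj := fun A => exist Q (F (sval A)) (PQ _ (svalP A))
               : full_subcategory Q;
     fmor := fun A B f => fmor F f |}.
Next Obligation. by move=> * /=; rewrite fmor_id. Qed.
Next Obligation. by move=> * /=; rewrite fmor_comp. Qed.

Lemma additive_ext (A B : zmodType) (f g : {additive A -> B}) : f =1 g -> f = g.
Proof.
case: f g => [f fP] [g gP] /= /funext fg; subst g.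
by case: fP gP => [[fD]] [[gD]]; rewrite (Prop_irrelevance fD gD).
Qed.

Lemma linear_ext (R : nzRingType) (U V : lmodType R) (f g : {linear U -> V}) :
  f =1 g -> f = g.
Proof.
case: f g => [f fP] [g gP] /= /funext fg; subst g.
case: fP gP => [[fD] [fZ]] [[gD] [gZ]].
by rewrite (Prop_irrelevance fD gD) (Prop_irrelevance fZ gZ).
Qed.

Program Definition Ab : category :=
  {| obj := zmodType;
     hom := fun A B => {additive A -> B};
     idm := fun A => idfun;
     compm := fun A B C g f => g \o f |}.
Next Obligation. by move=> *; apply: additive_ext. Qed.
Next Obligation. by move=> *; apply: additive_ext. Qed.
Next Obligation. by move=> *; apply: additive_ext. Qed.

Program Definition Mod (R : nzRingType) : category :=
  {| obj := lmodType R;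
     hom := fun U V => {linear U -> V};
     idm := fun U => idfun;
     compm := fun U V W g f => g \o f |}.
Next Obligation. by move=> *; apply: linear_ext. Qed.
Next Obligation. by move=> *; apply: linear_ext. Qed.
Next Obligation. by move=> *; apply: linear_ext. Qed.

Definition Vect : category := Mod 'F_2.

(* A Z-module killed by 2 is an F_2-vector space, c acting as the integer c. *)
Section ModuleF2.
Variables (V : zmodType) (V2 : forall v : V, v *+ 2 = 0).

Definition scaleF2 (c : 'F_2) (v : V) : V := v *+ (c : nat).

Lemma mulrn_mod2 (v : V) n : v *+ (n %% 2) = v *+ n.
Proof. by rewrite [in RHS](divn_eq n 2) mulrnDr mulnC mulrnA V2 mul0rn add0r. Qed.

Lemma scaleF2A a b v : scaleF2 a (scaleF2 b v) = scaleF2 (a * b) v.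
Proof. by rewrite /scaleF2 /= mulrn_mod2 -mulrnA mulnC. Qed.

Lemma scaleF21 : left_id 1 scaleF2.
Proof. by []. Qed.

Lemma scaleF2Dr : right_distributive scaleF2 +%R.
Proof. by move=> a u v; rewrite /scaleF2 mulrnDl. Qed.

Lemma scaleF2Dl v : {morph scaleF2^~ v : a b / a + b}.
Proof. by move=> a b; rewrite /scaleF2 /= mulrn_mod2 mulrnDr. Qed.

End ModuleF2.

Lemma scalerF2 (V : lmodType 'F_2) (c : 'F_2) (v : V) : c *: v = v *+ (c : nat).
Proof. by rewrite -{1}[c]natr_Zp scaler_nat. Qed.

Lemma additive_scalable (U V : lmodType 'F_2) (f : {additive U -> V}) :
  scalable f.
Proof. by move=> c u; rewrite !scalerF2 raddfMn. Qed.

Section Mod2.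
Variable A : zmodType.

(* mod2 A is A/2A and torsion2 A is the 2-torsion subgroup of A. *)
Definition doubles : {pred A} := fun a => `[< exists b, a = b *+ 2 >].

Lemma doubles_zmod_closed : zmod_closed doubles.
Proof.
split; first by apply/asboolP; exists 0; rewrite mul0rn.
move=> x y /asboolP[b ->] /asboolP[c ->].
by apply/asboolP; exists (b - c); rewrite mulrnBl.
Qed.
HB.instance Definition _ := GRing.isZmodClosed.Build A doubles doubles_zmod_closed.

Definition mod2 := {ideal_quot doubles}.
HB.instance Definition _ := ZmodQuotient.on mod2.

Lemma mod2_mul2n (x : mod2) : x *+ 2 = 0.
Proof.
rewrite -[x]reprK mulr2n -raddfD.
have -> : 0 = \pi_mod2 0 by rewrite raddf0.
apply/eqP; rewrite -Quotient.idealrBE subr0.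
by apply/asboolP; exists (repr x); rewrite mulr2n.
Qed.

HB.instance Definition _ := GRing.Zmodule_isLmodule.Build 'F_2 mod2
  (scaleF2A mod2_mul2n) (@scaleF21 mod2) (@scaleF2Dr mod2)
  (scaleF2Dl mod2_mul2n).

Definition killed2 : {pred A} := fun a => a *+ 2 == 0.

Lemma killed2_zmod_closed : zmod_closed killed2.
Proof.
split=> [|x y]; rewrite !unfold_in ?mul0rn // => /eqP x0 /eqP y0.
by rewrite mulrnBl x0 y0 subrr.
Qed.
HB.instance Definition _ :=
  GRing.isZmodClosed.Build A killed2 killed2_zmod_closed.

Definition torsion2 := {a : A | a \in killed2}.
HB.instance Definition _ := SubChoice.on torsion2.
HB.instance Definition _ := [SubChoice_isSubZmodule of torsion2 by <:].

Lemma torsion2_mul2n (x : torsion2) : x *+ 2 = 0.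
Proof. by apply: val_inj; rewrite raddfMn raddf0; apply/eqP/(valP x). Qed.

HB.instance Definition _ := GRing.Zmodule_isLmodule.Build 'F_2 torsion2
  (scaleF2A torsion2_mul2n) (@scaleF21 torsion2) (@scaleF2Dr torsion2)
  (scaleF2Dl torsion2_mul2n).

End Mod2.


Section Mod2Map.
Variables (A B : zmodType) (f : {additive A -> B}).

Definition mod2_map (x : mod2 A) : mod2 B := \pi_(mod2 B) (f (repr x)).

Lemma mod2_map_pi a : mod2_map (\pi_(mod2 A) a) = \pi_(mod2 B) (f a).
Proof.
apply/eqP; rewrite -Quotient.idealrBE -raddfB.
have /asboolP[b ab] : repr (\pi_(mod2 A) a) - a \in @doubles A.
  by rewrite Quotient.idealrBE reprK.
by apply/asboolP; exists (f b); rewrite ab raddfMn.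
Qed.

Lemma mod2_map_zmod : zmod_morphism mod2_map.
Proof.
by elim/quotW=> x; elim/quotW=> y; rewrite -raddfB !mod2_map_pi !raddfB.
Qed.
HB.instance Definition _ := GRing.isZmodMorphism.Build _ _ mod2_map mod2_map_zmod.
HB.instance Definition _ := GRing.isScalable.Build 'F_2 (mod2 A) (mod2 B) *:%R
  mod2_map (additive_scalable mod2_map).

Lemma torsion2_map_proof (x : torsion2 A) : f (val x) \in @killed2 B.
Proof. by rewrite unfold_in -raddfMn (eqP (valP x)) raddf0. Qed.

Definition torsion2_map (x : torsion2 A) : torsion2 B :=
  Sub (f (val x)) (torsion2_map_proof x).

Lemma torsion2_map_zmod : zmod_morphism torsion2_map.
Proof. by move=> x y; apply: val_inj; rewrite /= !raddfB. Qed.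
HB.instance Definition _ :=
  GRing.isZmodMorphism.Build _ _ torsion2_map torsion2_map_zmod.
HB.instance Definition _ := GRing.isScalable.Build 'F_2 (torsion2 A) (torsion2 B)
  *:%R torsion2_map (additive_scalable torsion2_map).

End Mod2Map.

Lemma mod2_map_id (A : zmodType) : mod2_map (@idfun A) =1 id.
Proof. by elim/quotW=> a; rewrite mod2_map_pi. Qed.

Lemma mod2_map_comp (A B C : zmodType)
    (g : {additive B -> C}) (f : {additive A -> B}) :
  mod2_map (g \o f) =1 mod2_map g \o mod2_map f.
Proof.
elim/quotW=> a; rewrite -[RHS]/(mod2_map g (mod2_map f (\pi_(mod2 A) a))).
by rewrite !mod2_map_pi.
Qed.

Program Definition mod2_functor : functor Ab Vect :=
  {| fobj := (fun A => mod2 A) : Ab -> Vect;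
     fmor := fun A B f => (mod2_map f : {linear _ -> _}) |}.
Next Obligation. by move=> A; apply: linear_ext; apply: mod2_map_id. Qed.
Next Obligation.
by move=> A B C g f; apply: linear_ext; apply: mod2_map_comp.
Qed.

Program Definition torsion2_functor : functor Ab Vect :=
  {| fobj := (fun A => torsion2 A) : Ab -> Vect;
     fmor := fun A B f => (torsion2_map f : {linear _ -> _}) |}.
Next Obligation. by move=> A; apply: linear_ext => a; apply: val_inj. Qed.
Next Obligation. by move=> *; apply: linear_ext => a; apply: val_inj. Qed.

Definition Vect2 : category := prod_category Vect Vect.

Definition t : functor Ab Vect2 := functor_pair mod2_functor torsion2_functor.

Section LinearExtension.
Variables (R : nzRingType) (K : choiceType) (V : lmodType R) (h : K -> V).

Definition malg_ext (g : {malg R[K]}) : V := \sum_(k <- msupp g) g@_k *: h k.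

Lemma malg_ext_supp (g : {malg R[K]}) (E : {fset K}) :
  msupp g `<=` E -> malg_ext g = \sum_(k <- E) g@_k *: h k.
Proof.
move=> gE; rewrite /malg_ext.
apply: big_fset_incl => // k _ /mcoeff_outdom ->; exact: scale0r.
Qed.

Lemma malg_ext_linear : linear malg_ext.
Proof.
move=> c g1 g2; pose E := msupp (c *: g1 + g2) `|` (msupp g1 `|` msupp g2).
have E1 : msupp g1 `<=` E by rewrite /E fsetUCA fsubsetUl.
have E2 : msupp g2 `<=` E by rewrite /E fsetUA fsubsetUr.
rewrite (malg_ext_supp E1) (malg_ext_supp E2).
rewrite (@malg_ext_supp _ E) ?fsubsetUl //.
rewrite scaler_sumr -big_split; apply: eq_bigr => k _ /=.
by rewrite mcoeffD mcoeffZ scalerDl scalerA.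
Qed.
HB.instance Definition _ :=
  GRing.isLinear.Build R {malg R[K]} V *:%R malg_ext malg_ext_linear.

Lemma malg_extU k : malg_ext << k >> = h k.
Proof.
by rewrite (malg_ext_supp msuppU_le) big_seq_fset1 mcoeffUU scale1r.
Qed.

End LinearExtension.

Lemma malg_linear_ind (R : nzRingType) (K : choiceType) (V : lmodType R)
  (f g : {linear {malg R[K]} -> V}) : (forall k, f << k >> = g << k >>) -> f =1 g.
Proof.
move=> fg x; rewrite [x]monalgE !linear_sum; apply: eq_bigr => k _.
have -> : << x@_k *g k >> = x@_k *: << k >> :> {malg R[K]}.
  by apply/malgP => j; rewrite mcoeffZ !mcoeffU mulrnAr mulr1.
by rewrite (linearZ_LR f) (linearZ_LR g) fg.
Qed.

(* Homology of the unnormalized inhomogeneous bar complex, with coefficients in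
   the trivial module R, of an abelian group in additive notation: C_n is free
   on the symbols [a_0|...|a_(n-1)], and d = sum_(i <= n) (-1)^i d_i where
   d_0 drops the first entry, d_n the last, and d_i adds a_(i-1) to a_i. *)
Section Bar.
Variable R : nzRingType.

Definition bar (n : nat) (A : zmodType) := {malg R[{ffun 'I_n -> A}]}.
HB.instance Definition _ n A := GRing.Lmodule.on (bar n A).

Section Differential.
Variable A : zmodType.

Definition bar_face (n i : nat) (a : {ffun 'I_n.+1 -> A}) : {ffun 'I_n -> A} :=
  [ffun j : 'I_n => if (j.+1 < i)%N then a (lift ord_max j)
                    else if j.+1 == i then a (lift ord_max j) + a (lift ord0 j)
                    else a (lift ord0 j)].

Definition bar_d (n : nat) : bar n.+1 A -> bar n A :=
  malg_ext (fun a => \sum_(i < n.+2) (-1) ^+ i *: << bar_face i a >>).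
HB.instance Definition _ n := GRing.Linear.on (@bar_d n).

Lemma bar_face_face n i j (a : {ffun 'I_n.+2 -> A}) : (j <= i)%N ->
  bar_face i (bar_face j a) = bar_face j (bar_face i.+1 a).
Proof.
move=> ji; apply/ffunP => k; rewrite !ffunE.
have -> : lift ord0 (lift ord_max k) = lift ord_max (lift ord0 k) :> 'I_n.+2.
  by apply: ord_inj; rewrite !(lift0, lift_max).
rewrite !(lift0, lift_max); move: (nat_of_ord k) (a _) (a _) (a _) => m x0 x1 x2.
rewrite !ltnS !eqSS.
case: (ltngtP m.+1 j) => jm; case: (ltngtP m.+1 i) => im; try lia; try by [].
all: have -> : (m.+2 < j)%N = false by lia.
all: have -> : (m.+2 == j) = false by lia.
all: by rewrite ?addrA.
Qed.

Lemma bar_dU n (a : {ffun 'I_n.+1 -> A}) :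
  bar_d << a >> = \sum_(i < n.+2) (-1) ^+ i *: << bar_face i a >>.
Proof. exact: malg_extU. Qed.

Lemma bar_dK n (c : bar n.+2 A) : bar_d (bar_d c) = 0.
Proof.
apply: (@malg_linear_ind _ _ _ (@bar_d n \o @bar_d n.+1) \0) => a.
rewrite /= [X in bar_d X]bar_dU linear_sum [RHS]/=.
pose F i j : bar n A := (-1) ^+ (i + j) *: << bar_face i (bar_face j a) >>.
have FS i j : (j <= i)%N -> F j i.+1 = - F i j.
  by move=> ji; rewrite /F -bar_face_face // addnS addnC exprS mulN1r scaleNr.
transitivity (\sum_(i < n.+2) \sum_(j < n.+3) F i j).
  rewrite exchange_big; apply: eq_bigr => j _ /=.
  rewrite linearZ /= bar_dU scaler_sumr; apply: eq_bigr => i _.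
  by rewrite scalerA -exprD addnC.
transitivity (\sum_(i < n.+2) (\sum_(j < n.+2 | (j <= i)%N) F i j
                             + \sum_(j < n.+2 | (i <= j)%N) F i j.+1)).
  apply: eq_bigr => i _; rewrite (bigID (fun j : 'I_n.+3 => (j <= i)%N)) /=.
  congr (_ + _).
    by rewrite big_mkcond big_ord_recr /= leqNgt ltn_ord addr0 -big_mkcond.
  rewrite big_mkcond big_ord_recl /= add0r [RHS]big_mkcond.
  by apply: eq_bigr => j _; rewrite -[bump 0 j]/j.+1 -ltnNge ltnS.
rewrite big_split /= [X in _ + X](exchange_big_dep predT) //= -big_split.
apply: big1 => i _ /=; rewrite -big_split; apply: big1 => j ji /=.
by rewrite FS // subrr.
Qed.

End Differential.

Section Homology.
Variables (n : nat) (A : zmodType).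

Definition bar_cycle : {pred bar n A} :=
  match n return {pred bar n A} with
  | 0 => predT
  | m.+1 => fun c => bar_d c == 0
  end.

Lemma bar_cycle_submod_closed : GRing.submod_closed bar_cycle.
Proof.
rewrite /bar_cycle; case: n => [|m]; split=> // [|a u v].
  by rewrite unfold_in linear0.
rewrite !unfold_in => /eqP u0 /eqP v0.
by rewrite linearP /= u0 v0 scaler0 addr0.
Qed.
HB.instance Definition _ :=
  GRing.isSubmodClosed.Build R (bar n A) bar_cycle bar_cycle_submod_closed.

Definition cycles := {c : bar n A | c \in bar_cycle}.
HB.instance Definition _ := SubChoice.on cycles.
HB.instance Definition _ := [SubChoice_isSubLmodule of cycles by <:].

Definition bar_boundary : {pred cycles} :=
  fun z => `[< exists b : bar n.+1 A, bar_d b = val z >].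

Lemma bar_boundary_submod_closed : GRing.submod_closed bar_boundary.
Proof.
split=> [|a u v].
  by apply/asboolP; exists 0; rewrite linear0 [RHS]raddf0.
move=> /asboolP[b bu] /asboolP[c cv]; apply/asboolP; exists (a *: b + c).
by rewrite linearP /= bu cv.
Qed.
HB.instance Definition _ := GRing.isSubmodClosed.Build R cycles bar_boundary
  bar_boundary_submod_closed.

Definition homology := {ideal_quot bar_boundary}.
HB.instance Definition _ := ZmodQuotient.on homology.

Lemma homologyW (P : homology -> Type) :
  (forall z, P (\pi_homology z)) -> forall x, P x.
Proof. exact: quotW. Qed.

Definition scale_homology (a : R) (x : homology) : homology :=
  \pi_homology (a *: repr x).

Lemma scale_homology_pi a z :
  scale_homology a (\pi_homology z) = \pi_homology (a *: z).
Proof.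
apply/eqP; rewrite -Quotient.idealrBE -scalerBr; apply: rpredZ.
by rewrite Quotient.idealrBE reprK.
Qed.

Lemma scale_homologyA a b x :
  scale_homology a (scale_homology b x) = scale_homology (a * b) x.
Proof. by elim/homologyW: x => x; rewrite !scale_homology_pi scalerA. Qed.

Lemma scale_homology1 : left_id 1 scale_homology.
Proof. by elim/homologyW=> x; rewrite scale_homology_pi scale1r. Qed.

Lemma scale_homologyDr : right_distributive scale_homology +%R.
Proof.
move=> a; elim/homologyW=> x; elim/homologyW=> y.
by rewrite -raddfD !scale_homology_pi scalerDr raddfD.
Qed.

Lemma scale_homologyDl x : {morph scale_homology^~ x : a b / a + b}.
Proof.
by elim/homologyW: x => x a b; rewrite !scale_homology_pi scalerDl raddfD.
Qed.

HB.instance Definition _ := GRing.Zmodule_isLmodule.Build R homology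
  scale_homologyA scale_homology1 scale_homologyDr scale_homologyDl.

End Homology.

Section HomologyMap.
Variables (A B : zmodType) (f : {additive A -> B}).

Definition bar_map (n : nat) : bar n A -> bar n B :=
  malg_ext (fun a : {ffun 'I_n -> A} => << [ffun i => f (a i)] >> : bar n B).
HB.instance Definition _ n := GRing.Linear.on (@bar_map n).

Lemma bar_mapU n (a : {ffun 'I_n -> A}) :
  bar_map << a >> = << [ffun i => f (a i)] >>.
Proof. exact: malg_extU. Qed.

Lemma bar_map_d n (c : bar n.+1 A) : bar_map (bar_d c) = bar_d (bar_map c).
Proof.
apply: (@malg_linear_ind _ _ _ (@bar_map n \o @bar_d _ n)
          (@bar_d _ n \o @bar_map n.+1)) => a.
rewrite /= bar_dU bar_mapU bar_dU linear_sum; apply: eq_bigr => i _ /=.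
rewrite linearZ /= bar_mapU; congr (_ *: << _ >>); apply/ffunP => j.
by rewrite !ffunE; case: ifP => // _; case: ifP => // _; rewrite raddfD.
Qed.

Lemma bar_map_cycle n (z : cycles n A) : bar_map (val z) \in @bar_cycle n B.
Proof.
case: n z => [|n] // [c cP]; rewrite unfold_in -bar_map_d.
by rewrite (eqP cP) linear0.
Qed.

Definition cycles_map n (z : cycles n A) : cycles n B :=
  Sub (bar_map (val z)) (bar_map_cycle z).

Definition homology_map n (x : homology n A) : homology n B :=
  \pi_(homology n B) (cycles_map (repr x)).

Lemma cycles_map_linear n : linear (@cycles_map n).
Proof. by move=> a x y; apply: val_inj; rewrite /= !linearP. Qed.
HB.instance Definition _ n := GRing.isLinear.Build R (cycles n A) (cycles n B)
  *:%R (@cycles_map n) (@cycles_map_linear n).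

Lemma homology_map_pi n z :
  homology_map (\pi_(homology n A) z) = \pi_(homology n B) (cycles_map z).
Proof.
apply/eqP; rewrite -Quotient.idealrBE -raddfB.
have /asboolP[b bz] : repr (\pi_(homology n A) z) - z \in @bar_boundary n A.
  by rewrite Quotient.idealrBE reprK.
by apply/asboolP; exists (bar_map b); rewrite -bar_map_d bz.
Qed.

Lemma homology_map_linear n : linear (@homology_map n).
Proof.
move=> a; elim/homologyW=> x; elim/homologyW=> y.
rewrite [a *: _]scale_homology_pi -raddfD !homology_map_pi linearP raddfD.
by rewrite [a *: _ in RHS]scale_homology_pi.
Qed.
HB.instance Definition _ n := GRing.isLinear.Build R (homology n A)
  (homology n B) *:%R (@homology_map n) (@homology_map_linear n).

End HomologyMap.

Lemma bar_map_id n (A : zmodType) (c : bar n A) : bar_map idfun c = c.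
Proof.
apply: (@malg_linear_ind _ _ _ (@bar_map _ _ idfun n) idfun) => a /=.
by rewrite bar_mapU; congr << _ >>; apply/ffunP => i; rewrite ffunE.
Qed.

Lemma bar_map_comp n (A B C : zmodType)
    (g : {additive B -> C}) (f : {additive A -> B}) (c : bar n A) :
  bar_map (g \o f) c = bar_map g (bar_map f c).
Proof.
apply: (@malg_linear_ind _ _ _ (@bar_map _ _ (g \o f) n)
          (@bar_map _ _ g n \o @bar_map _ _ f n)) => a /=.
by rewrite !bar_mapU; congr << _ >>; apply/ffunP => i; rewrite !ffunE.
Qed.

Lemma homology_map_id n (A : zmodType) : @homology_map A A idfun n =1 id.
Proof.
elim/homologyW=> z; rewrite homology_map_pi; congr (\pi_(homology n A) _).
by apply: val_inj; rewrite /= bar_map_id.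
Qed.

Lemma homology_map_comp n (A B C : zmodType)
    (g : {additive B -> C}) (f : {additive A -> B}) :
  @homology_map A C (g \o f) n =1 @homology_map B C g n \o @homology_map A B f n.
Proof.
elim/homologyW=> z.
rewrite -[RHS]/(homology_map g (homology_map f (\pi_(homology n A) z))).
rewrite !homology_map_pi; congr (\pi_(homology n C) _).
by apply: val_inj; rewrite /= bar_map_comp.
Qed.

End Bar.

Program Definition group_homology (R : nzRingType) (n : nat) : functor Ab (Mod R) :=
  {| fobj := (fun A => homology R n A) : Ab -> Mod R;
     fmor := fun A B f => (@homology_map R A B f n : {linear _ -> _}) |}.
Next Obligation. by move=> *; apply: linear_ext; apply: homology_map_id. Qed.
Next Obligation. by move=> *; apply: linear_ext; apply: homology_map_comp. Qed.

Definition fin_gen (A : zmodType) : Prop :=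
  exists (k : nat) (s : 'I_k -> A),
    forall a, exists c : 'I_k -> int, a = \sum_i s i *~ c i.

Definition fin_dim (V : lmodType 'F_2) : Prop :=
  exists (k : nat) (s : 'I_k -> V),
    forall v, exists c : 'I_k -> 'F_2, v = \sum_i c i *: s i.

Lemma fin_gen_dim (V : lmodType 'F_2) : fin_gen V -> fin_dim V.
Proof.
move=> [k [s sV]]; exists k, s => v; have [c ->] := sV v.
by exists (fun i => (c i)%:~R); apply: eq_bigr => i _; rewrite scaler_int.
Qed.

Lemma int_ideal_principal (I : int -> Prop) :
  I 0 -> (forall x y, I x -> I y -> I (x - y)) ->
  exists2 d, I d & forall x, I x -> exists q, x = q * d.
Proof.
move=> I0 IB.
have IN x : I x -> I (- x) by move=> Ix; rewrite -sub0r; apply: IB.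
have IM x (q : int) : I x -> I (q * x).
  have Mn (k : nat) : I x -> I (k%:Z * x).
    move=> Ix; elim: k => [|k IHk]; first by rewrite mul0r.
    by rewrite intS mulrDl mul1r -[k%:Z * x]opprK; apply/IB/IN.
  by case: q => k Ix; [apply: Mn | rewrite NegzE mulNr; apply/IN/Mn].
have [[m Im m0]|all0] := pselect (exists2 m, I m & m != 0); last first.
  exists 0 => // x Ix; exists 0; rewrite mulr0.
  by apply: contra_notP all0 => /eqP x0; exists x.
pose P (k : nat) := (0 < k)%N && `[< I k%:Z >].
have exP : exists k, P k.
  exists `|m|%N; rewrite /P absz_gt0 m0; apply/asboolP.
  have [->|->] // : `|m|%N%:Z = m \/ `|m|%N%:Z = - m by lia.
  exact: IN.
case: (ex_minnP exP) => d /andP[d0 /asboolP Id] dmin; exists d%:Z => // x Ix.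
exists (x %/ d)%Z; apply/eqP; rewrite -subr_eq0.
have dE : x - (x %/ d)%Z * d%:Z = (x %% d)%Z by [].
have Ir : I (x %% d)%Z by rewrite -dE; apply/IB/IM.
rewrite dE; have r0 : (0 <= (x %% d)%Z)%R by apply: modz_ge0; case: d d0 {dmin Id Ir dE}.
have := ltz_pmod x (d0 : (0 < d%:Z)%R).
case: (x %% d)%Z r0 Ir => [[|r]|//] // _ Ir rd.
have /dmin : P r.+1 by apply/asboolP.
by rewrite leqNgt -ltz_nat rd.
Qed.

Lemma fin_gen_subgroup (A : zmodType) k (s : 'I_k -> A) (P : A -> Prop) :
  P 0 -> (forall x y, P x -> P y -> P (x - y)) ->
  (forall a, P a -> exists c : 'I_k -> int, a = \sum_i s i *~ c i) ->
  exists2 g : 'I_k -> A, forall i, P (g i) &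
    forall a, P a -> exists c : 'I_k -> int, a = \sum_i g i *~ c i.
Proof.
elim: k s P => [|k IHk] s P P0 PB Ps; first by exists s => // -[].
have PN x : P x -> P (- x) by move=> Px; rewrite -sub0r; apply: PB.
have PD x y : P x -> P y -> P (x + y).
  by move=> Px Py; rewrite -[y]opprK; apply/PB/PN.
have PM x (q : int) : P x -> P (x *~ q).
  have Mn (m : nat) : P x -> P (x *+ m).
    by move=> Px; elim: m => // m IHm; rewrite mulrS; apply: PD.
  by case: q => m Px; [apply: Mn | rewrite NegzE mulrNz; apply/PN/Mn].
pose span (b : A) := exists c : 'I_k -> int, b = \sum_i s (lift ord0 i) *~ c i.
have spanB b c : span b -> span c -> span (b - c).
  move=> [x ->] [y ->]; exists (fun i => x i - y i).
  by rewrite -sumrB; apply: eq_bigr => i _; rewrite mulrzBr.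
have span0 : span 0 by exists (fun=> 0); rewrite big1.
have spanM b (q : int) : span b -> span (b *~ q).
  move=> [x ->]; exists (fun i => x i * q); rewrite mulrz_suml.
  by apply: eq_bigr => i _; rewrite mulrzA.
pose I (x : int) := exists2 b, span b & P (s ord0 *~ x + b).
have [||d [b0 b0s Pb0] dI] := @int_ideal_principal I.
- by exists 0; rewrite // addr0.
- move=> x y [b bs Pb] [c cs Pc]; exists (b - c); first exact: spanB.
  by rewrite mulrzBr addrACA -opprD; apply: PB.
have [|||g gP gs] := IHk (fun i => s (lift ord0 i)) (fun a => P a /\ span a).
- by [].
- by move=> x y [Px sx] [Py sy]; split; [apply: PB | apply: spanB].
- by move=> a [].
pose h i := oapp g (s ord0 *~ d + b0) (unlift ord0 i).
exists h => [i|a Pa]; first by rewrite /h; case: unliftP => //= j _; case: (gP j).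
have [c ac] := Ps a Pa.
have [q cq] : exists q, c ord0 = q * d.
  apply: dI; exists (\sum_i s (lift ord0 i) *~ c (lift ord0 i)).
    by exists (fun i => c (lift ord0 i)).
  by rewrite big_ord_recl in ac; rewrite -ac.
have [|e ae] := gs (a - (s ord0 *~ d + b0) *~ q).
  split; first by apply/PB/PM.
  rewrite ac big_ord_recl cq mulrzDl -mulrzA [d * q]mulrC opprD addrACA subrr add0r.
  by apply: spanB; [exists (fun i => c (lift ord0 i)) | apply: spanM].
exists (fun i => oapp e q (unlift ord0 i)).
rewrite big_ord_recl /h unlift_none /= -[LHS](subrK ((s ord0 *~ d + b0) *~ q)).
rewrite addrC; congr (_ + _); rewrite ae.
by apply: eq_bigr => i _; rewrite liftK.
Qed.

Lemma mod2_fin_gen (A : zmodType) : fin_gen A -> fin_gen (mod2 A).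
Proof.
move=> [k [s sA]]; exists k, (fun i => \pi_(mod2 A) (s i)); elim/quotW=> a.
have [c ->] := sA a; exists c; rewrite raddf_sum.
by apply: eq_bigr => i _; rewrite raddfMz.
Qed.

Lemma torsion2_fin_gen (A : zmodType) : fin_gen A -> fin_gen (torsion2 A).
Proof.
move=> [k [s sA]].
have [|||g gP gA] := @fin_gen_subgroup A k s (fun a => a \in @killed2 A).
- exact: rpred0.
- by move=> x y; apply: rpredB.
- by move=> a _.
exists k, (fun i => Sub (g i) (gP i)) => a.
have [c ac] := gA (val a) (valP a); exists c; apply: val_inj.
by rewrite ac raddf_sum; apply: eq_bigr => i _; rewrite raddfMz.
Qed.

Definition AbFg : category := full_subcategory (C := Ab) fin_gen.
Definition VectFd : category := full_subcategory (C := Vect) fin_dim.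
Definition VectFd2 : category := prod_category VectFd VectFd.

Definition t_fg : functor AbFg VectFd2 :=
  functor_pair
    (restriction (F := mod2_functor)
       (fun A fgA => fin_gen_dim (mod2_fin_gen fgA)))
    (restriction (F := torsion2_functor)
       (fun A fgA => fin_gen_dim (torsion2_fin_gen fgA))).

(* Main.v *)
(** Write L = (F_2, 0) and M = (0, F_2), let x be the generator of H^1(Z/2), and
    take n = 2 first.  Sum and second projection Z x Z/2 -> Z/2 pull x^2 back to the
    same class, since x^2 vanishes on Z; under t they become the maps
    L + L + M -> L + M given by sum and second projection on L + L.  Composing with
    the inclusion of the first L and the M, which comes from no homomorphism
    Z/2 -> Z x Z/2, shows that x^2 is invariant under the idempotent w of L + M
    that kills L.  If z generates H_2(Z/2), the diagonal D : Z/2 -> (Z/2)^2 satisfies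
    D z = i_1 z + i_2 z + r, where r comes from H_2(Z^2).  Apply w: the term r then
    factors through the zero homomorphism of Z^2, so that the cross product
    x_1 x_2 vanishes on w D z, although x_1 x_2 (D z) = x^2 (z) = 1.
    For n = m + 2, multiply every group by Z^m and every class by the product of
    the generators of H_1(Z^m). *)

From HB Require Import structures.
From mathcomp Require Import all_boot all_order all_algebra.
From mathcomp Require Import ring_quotient boolp.
From mathcomp Require Import monalg zify ring ssrAC.
Require Import Defs.

Set Implicit Arguments.
Unset Strict Implicit.
Unset Printing Implicit Defensive.

Import GRing.Theory.
Local Open Scope ring_scope.
Local Open Scope quotient_scope.

(** * Suspension by a 1-cycle *)

Lemma addrr_F2 (V : lmodType 'F_2) (v : V) : v + v = 0.
Proof.
by rewrite -mulr2n -(scaler_nat 2 v) (_ : 2%:R = 0) ?scale0r //; apply: val_inj.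
Qed.

Lemma opprF2 (V : lmodType 'F_2) (v : V) : - v = v.
Proof. by apply/eqP; rewrite eq_sym -subr_eq0 opprK addrr_F2. Qed.

Lemma signr_F2 i : (-1) ^+ i = 1 :> 'F_2.
Proof. by rewrite (_ : -1 = 1) ?expr1n //; apply: val_inj. Qed.

Lemma bar_dU_F2 (A : zmodType) n (a : {ffun 'I_n.+1 -> A}) :
  bar_d << a >> = \sum_(0 <= i < n.+2) << bar_face i a >> :> bar 'F_2 n A.
Proof.
rewrite bar_dU big_mkord; apply: eq_bigr => i _.
by rewrite signr_F2 scale1r.
Qed.

Section Symbols.
Variable A : zmodType.
Implicit Types (e : A) (n p i k : nat).

(** Indexing by natural numbers, with value 0 out of range, turns identities between faces into
    index arithmetic; homomorphisms preserve the default value. *)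
Definition entry n (a : {ffun 'I_n -> A}) i : A := oapp a 0 (insub i).

Lemma entry_ord n (a : {ffun 'I_n -> A}) (i : 'I_n) : entry a i = a i.
Proof. by rewrite /entry valK. Qed.

Lemma entry_finfun n (g : nat -> A) i :
  (i < n)%N -> entry [ffun j : 'I_n => g j] i = g i.
Proof. by move=> lt_in; rewrite /entry insubT /= ffunE. Qed.

Lemma eq_entry n (a b : {ffun 'I_n -> A}) :
  (forall i, (i < n)%N -> entry a i = entry b i) -> a = b.
Proof. by move=> ab; apply/ffunP => i; rewrite -!entry_ord ab. Qed.

Lemma entry_face n i (a : {ffun 'I_n.+1 -> A}) k : (k < n)%N ->
  entry (bar_face i a) k =
    if (k.+1 < i)%N then entry a k
    else if k.+1 == i then entry a k + entry a k.+1 else entry a k.+1.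
Proof.
move=> lt_kn; pose o := Ordinal lt_kn.
rewrite -[LHS]/(entry (bar_face i a) o) entry_ord ffunE /= -!entry_ord.
by rewrite !(lift0, lift_max).
Qed.

Definition insert n p e (a : {ffun 'I_n -> A}) : {ffun 'I_n.+1 -> A} :=
  [ffun j : 'I_n.+1 => if (j < p)%N then entry a j
                       else if j == p :> nat then e else entry a j.-1].

Lemma entry_insert n p e (a : {ffun 'I_n -> A}) k : (k <= n)%N ->
  entry (insert p e a) k =
    if (k < p)%N then entry a k else if k == p then e else entry a k.-1.
Proof.
by move=> le_kn; rewrite (entry_finfun (fun j => if (j < p)%N then entry a j
                       else if j == p then e else entry a j.-1)).
Qed.

(** Face [i] involves no entry beyond index [i], hence only entries to the left of the inserted [e],
    whose position drops by one. *)
Lemma face_insert_lt n i p e (a : {ffun 'I_n.+1 -> A}) : (i <= p)%N -> (p <= n)%N ->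
  bar_face i (insert p.+1 e a) = insert p e (bar_face i a).
Proof.
move=> le_ip le_pn; apply: eq_entry => k lt_kn.
rewrite entry_face // !entry_insert //; try lia.
case: (ltngtP k p) => kp.
- rewrite entry_face; last lia.
  by do ?[case: ifP; try lia].
- rewrite entry_face; last lia.
  case: k kp lt_kn => // k kp lt_kn /=.
  by do ?[case: ifP; try lia].
- by do ?[case: ifP; try lia].
Qed.

Lemma face_insert_gt n i p e (a : {ffun 'I_n.+1 -> A}) :
  (p < i)%N -> (p <= n)%N ->
  bar_face i.+1 (insert p e a) = insert p e (bar_face i a).
Proof.
move=> lt_pi le_pn; apply: eq_entry => k lt_kn.
rewrite entry_face // !entry_insert //; try lia.
case: (ltngtP k p) => kp.
- rewrite entry_face; last lia.
  by do ?[case: ifP; try lia].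
- rewrite entry_face; last lia.
  case: k kp lt_kn => // k kp lt_kn /=.
  by do ?[case: ifP; try lia].
- by do ?[case: ifP; try lia].
Qed.

(** Commutativity of [A] enters here: the merged entry is [a_p + e] on one side and [e + a_p] on the
    other. *)
Lemma face_insert_diag n p e (a : {ffun 'I_n.+1 -> A}) : (p <= n)%N ->
  bar_face p.+1 (insert p.+1 e a) = bar_face p.+1 (insert p e a).
Proof.
move=> le_pn; apply: eq_entry => k lt_kn.
rewrite !entry_face // !entry_insert //; try lia.
case: (ltngtP k p) => kp; last first.
  rewrite kp !ltnn !eqxx ltnSn (_ : (p.+1 < p) = false)%N ?gtn_eqF //=; last lia.
  by rewrite addrC.
all: by do ?[case: ifP; try lia].
Qed.

Lemma face_insert_first n e (a : {ffun 'I_n.+1 -> A}) :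
  bar_face 0 (insert 0 e a) = a.
Proof.
by apply: eq_entry => k lt_kn; rewrite entry_face //= entry_insert.
Qed.

Lemma face_insert_last n e (a : {ffun 'I_n.+1 -> A}) :
  bar_face n.+2 (insert n.+1 e a) = a.
Proof.
apply: eq_entry => k lt_kn; rewrite entry_face // entry_insert; last lia.
by do ?[case: ifP; try lia].
Qed.

(* The Pontryagin product with the 1-cycle [e]: signs vanish over F_2. *)
Definition suspend n e : bar 'F_2 n A -> bar 'F_2 n.+1 A :=
  malg_ext (fun a : {ffun 'I_n -> A} =>
    \sum_(0 <= p < n.+1) << insert p e a >> : bar 'F_2 n.+1 A).
HB.instance Definition _ n e := GRing.Linear.on (@suspend n e).

Lemma suspendU n e (a : {ffun 'I_n -> A}) :
  suspend e << a >> = \sum_(0 <= p < n.+1) << insert p e a >>.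
Proof. exact: malg_extU. Qed.

(** Leibniz rule for the shuffle product with [e], where d[e] = 0: the faces away from [e] commute
    with the insertion, and those involving [e] telescope. *)
Lemma bar_d_suspend n e (c : bar 'F_2 n.+1 A) :
  bar_d (suspend e c) = suspend e (bar_d c).
Proof.
apply: (@malg_linear_ind _ _ _ (@bar_d _ _ n.+1 \o @suspend n.+1 e)
          (@suspend n e \o @bar_d _ _ n)) => a /=.
rewrite suspendU bar_dU_F2 !linear_sum /=.
pose G i p : bar 'F_2 n.+1 A := << bar_face i (insert p e a) >>.
pose H p i : bar 'F_2 n.+1 A := << insert p e (bar_face i a) >>.
(* [D p] and [D p.+1] are the two faces of [insert p e a] that involve [e]; the extreme values [D 0]
   and [D n.+2] are both [<< a >>]. *)
pose D p := if p == n.+2 then << a >> else G p p.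
under eq_bigr do rewrite bar_dU_F2.
under [RHS]eq_bigr do rewrite suspendU.
rewrite [RHS]exchange_big_nat /=.
transitivity (\sum_(0 <= p < n.+2) (\sum_(0 <= i < p) H p.-1 i
     + (D p.+1 - D p) + \sum_(p.+1 <= i < n.+2) H p i)).
  apply: eq_big_nat => p /andP[_ lt_pn].
  rewrite (big_cat_nat (n := p)) //=; last lia.
  rewrite (big_ltn (m := p)); last lia.
  rewrite (big_ltn (m := p.+1)); last lia.
  rewrite !addrA; congr (_ + _); last first.
    rewrite big_add1 /=; apply: eq_big_nat => i ?.
    by rewrite /H face_insert_gt //; lia.
  rewrite -!addrA; congr (_ + _).
    apply: eq_big_nat => i ?.
    by rewrite /H -[p in LHS](prednK (n := p)) ?face_insert_lt //; lia.
  rewrite opprF2 addrC /D; congr (_ + _); last by case: eqP => //; lia.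
  case: eqP => [[->]|?]; first by rewrite face_insert_last.
  by rewrite /G face_insert_diag //; lia.
rewrite 2!big_split /= telescope_sumr // {1}/D eqxx {1}/D /= /G face_insert_first.
rewrite subrr addr0.
(* The first family is empty at [p = 0] and the second at [p = n.+1]; after a shift of [p] in the
   first, the ranges [i <= p] and [p < i] fit together. *)
rewrite big_nat_recl // big_geq // add0r.
rewrite [X in _ + X]big_nat_recr // [X in _ + (_ + X)]big_geq // addr0.
rewrite -big_split; apply: eq_big_nat => p ?.
by rewrite -big_cat_nat //; lia.
Qed.

End Symbols.

(** * Cup products of functions and bar chains of low degree *)

Section Cup.
Variable A : zmodType.
Implicit Types (psi : nat -> A -> 'F_2) (e : A).

(** The cup product of the 1-cochains [psi 0], ..., [psi n.-1], evaluated on chains. *)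
Definition cup n psi : bar 'F_2 n A -> ('F_2)^o :=
  malg_ext (fun a : {ffun 'I_n -> A} => \prod_(i < n) psi i (a i) : ('F_2)^o).
HB.instance Definition _ n psi := GRing.Linear.on (@cup n psi).

Lemma cupU n psi (a : {ffun 'I_n -> A}) :
  cup psi << a >> = \prod_(0 <= k < n) psi k (entry a k).
Proof.
by rewrite [LHS]malg_extU big_mkord; apply: eq_bigr => i _; rewrite entry_ord.
Qed.

(** The additive factors are cocycles, so only the coboundary of [psi 0] survives; [psi 0] itself
    stays arbitrary, so that it can be a cobounding function. *)
Lemma cup_dU n psi (a : {ffun 'I_n.+2 -> A}) :
  (forall k, (0 < k <= n)%N -> {morph psi k : x y / x + y}) ->
  cup psi (bar_d << a >>) =
    (psi 0 (entry a 0) + psi 0 (entry a 0 + entry a 1) + psi 0 (entry a 1))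
    * \prod_(1 <= k < n.+1) psi k (entry a k.+1).
Proof.
move=> psiD; rewrite bar_dU_F2 linear_sum /=.
set P := \prod_(1 <= k < n.+1) psi k (entry a k.+1).
(* [T j] is the product over [a] with entry [j] omitted. By additivity an inner face, which merges
   two neighbours, gives a sum of two consecutive [T], and these sums telescope. *)
pose T j := \prod_(0 <= k < n.+1) psi k (entry a (if (k < j)%N then k else k.+1)).
have tail : \prod_(1 <= k < n.+1) psi k (entry a (if (k < 1)%N then k else k.+1))
          = P.
  by apply: eq_big_nat => k /andP[k1 _]; rewrite ltnNge k1.
have E0 : cup psi << bar_face 0 a >> = psi 0 (entry a 1) * P.
  rewrite cupU big_ltn // entry_face //=; congr (_ * _).
  by apply: eq_big_nat => k /andP[_ kn]; rewrite entry_face.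
have E1 : cup psi << bar_face 1 a >>
    = psi 0 (entry a 0 + entry a 1) * P.
  rewrite cupU big_ltn // entry_face //=; congr (_ * _).
  apply: eq_big_nat => k /andP[k1 kn]; rewrite entry_face //.
  by case: k k1 kn.
have T1 : T 1%N = psi 0 (entry a 0) * P.
  by rewrite /T big_ltn // tail.
have EL : cup psi << bar_face n.+2 a >> = T n.+1.
  rewrite cupU; apply: eq_big_nat => k /andP[_ kn].
  by rewrite entry_face // ltnS kn.
have EM i : (i < n)%N -> cup psi << bar_face i.+2 a >> = T i.+2 - T i.+1.
  move=> lt_in; rewrite [RHS](_ : _ = T i.+2 + T i.+1); last first.
    by congr (_ + _); exact: (opprF2 (T i.+1 : ('F_2)^o)).
  have split3 (F : nat -> 'F_2) : \prod_(0 <= k < n.+1) F k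
      = \prod_(0 <= k < i.+1) F k * F i.+1 * \prod_(i.+2 <= k < n.+1) F k.
    by rewrite -big_nat_recr //= -big_cat_nat //; lia.
  rewrite cupU /T !split3 entry_face //.
  rewrite ltnn eqxx ltnSn ltnn psiD; last lia.
  rewrite mulrDr mulrDl; congr (_ * _ * _ + _ * _ * _); apply: eq_big_nat => k ?;
    rewrite entry_face; try lia; do ?[case: ifP; try lia] => //.
rewrite big_ltn // big_ltn // big_nat_recr //= E0 E1 EL 2!big_add1 /=.
under eq_big_nat => i /andP[_ lt_in] do rewrite EM //.
rewrite (telescope_sumr (fun i => T i.+1)) //.
rewrite -[LHS]/(psi 0 (entry a 1) * P + (psi 0 (entry a 0 + entry a 1) * P
  + (T n.+1 - T 1%N + T n.+1)) : 'F_2).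
rewrite addrAC (addrr_F2 (T n.+1 : ('F_2)^o)) add0r (opprF2 (T 1%N : ('F_2)^o)) T1.
rewrite -!mulrDl.
by congr (_ * _); rewrite addrC [X in X + _]addrC.
Qed.

Lemma cup_boundary n psi (b : bar 'F_2 n.+2 A) :
  (forall k, (k <= n)%N -> {morph psi k : x y / x + y}) ->
  cup psi (bar_d b) = 0.
Proof.
move=> psiD.
apply: (@malg_linear_ind _ _ _ (@cup n.+1 psi \o @bar_d _ _ n.+1) \0) => a /=.
rewrite cup_dU => [|k /andP[_ kn]]; last exact: psiD.
rewrite psiD // addrA (addrr_F2 (psi 0 (entry a 0) : ('F_2)^o)) add0r.
by rewrite (addrr_F2 (psi 0 (entry a 1) : ('F_2)^o)) mul0r.
Qed.

(** The two cochains differ by the coboundary of [beta] times the common additive factors, which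
    vanishes on a cycle. *)
Lemma cup_cohomologous n psi psi' (beta : A -> 'F_2) (c : bar 'F_2 n.+2 A) :
  (forall x y, psi 0 x * psi 1 y + psi' 0 x * psi' 1 y
               = beta x + beta (x + y) + beta y) ->
  (forall k, (1 < k)%N -> psi' k = psi k) ->
  (forall k, (1 < k)%N -> {morph psi k : x y / x + y}) ->
  bar_d c = 0 -> cup psi c = cup psi' c.
Proof.
move=> betaP psi'E psiD dc0.
(* [beta] takes the place of the first two factors, so the later ones move down by one index. *)
pose chi k := if k is 0 then beta else psi k.+1.
have H : (@cup n.+1 chi \o @bar_d _ _ n.+1) =1 (@cup n.+2 psi \+ @cup n.+2 psi').
  apply: malg_linear_ind => a /=.
  rewrite cup_dU => [|[|k] //= _]; last exact: psiD.
  rewrite /= -betaP !cupU.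
  rewrite !(big_ltn (m := 0) (n := n.+2)) // !(big_ltn (m := 1) (n := n.+2)) //.
  rewrite !mulrA mulrDl !big_add1 /=.
  by congr (_ + _ * _); apply: eq_bigr => i _; rewrite psi'E.
have := H c; rewrite /= dc0 linear0 => H0.
by rewrite -[LHS]addr0 H0 addrA addrr_F2 add0r.
Qed.

(** Only the shuffle with [e] in last place survives: elsewhere [e] meets a factor that vanishes on
    it. *)
Lemma cup_suspend n psi e (c : bar 'F_2 n A) :
  (forall k, (k < n)%N -> psi k e = 0) -> psi n e = 1 ->
  cup psi (suspend e c) = cup psi c.
Proof.
move=> psi0 psi1.
apply: (@malg_linear_ind _ _ _ (@cup n.+1 psi \o @suspend _ n e)
          (@cup n psi)) => a /=.
rewrite suspendU linear_sum big_nat_recr //= big_nat big1 => [|p /andP[_ lt_pn]].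
  rewrite add0r !cupU big_nat_recr //= entry_insert // ltnn eqxx psi1 mulr1.
  by apply: eq_big_nat => k /andP[_ lt_kn]; rewrite entry_insert ?lt_kn // ltnW.
rewrite cupU (big_cat_nat (n := p)) //=; last lia.
rewrite [X in _ * X]big_ltn; last lia.
by rewrite entry_insert ?ltnn ?eqxx ?psi0 ?mul0r ?mulr0 // ltnW.
Qed.

End Cup.

Section Functoriality.
Variables (A B : zmodType) (f : {additive A -> B}).

Lemma entry_map n (a : {ffun 'I_n -> A}) k :
  entry [ffun i => f (a i)] k = f (entry a k).
Proof.
rewrite /entry; case: insubP => [i _ _|_] /=; first by rewrite ffunE.
by rewrite raddf0.
Qed.

Lemma cup_map n (psi : nat -> B -> 'F_2) (c : bar 'F_2 n A) :
  cup psi (bar_map f c) = cup (fun k => psi k \o f) c.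
Proof.
apply: (@malg_linear_ind _ _ _ (@cup _ n psi \o @bar_map _ _ _ f n)
   (@cup _ n (fun k => psi k \o f))) => a /=.
by rewrite bar_mapU !cupU; apply: eq_bigr => i _; rewrite entry_map.
Qed.

Lemma bar_map_suspend n e (c : bar 'F_2 n A) :
  bar_map f (suspend e c) = suspend (f e) (bar_map f c).
Proof.
apply: (@malg_linear_ind _ _ _ (@bar_map _ _ _ f n.+1 \o @suspend _ n e)
   (@suspend _ n (f e) \o @bar_map _ _ _ f n)) => a /=.
rewrite bar_mapU !suspendU linear_sum; apply: eq_bigr => p _ /=.
rewrite bar_mapU; congr << _ >>; apply/ffunP => j; rewrite !ffunE.
by rewrite !entry_map; do ?case: ifP.
Qed.

End Functoriality.

(** * Explicit chains and cycles in degrees 1 to 3 *)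

Section LowDegree.
Variable A : zmodType.
Implicit Types a b c : A.

Definition word n (s : seq A) : {ffun 'I_n -> A} :=
  [ffun i => nth 0 s (nat_of_ord i)].

Lemma entry_word n s k : (k < n)%N -> entry (word n s) k = nth 0 s k.
Proof. exact: (entry_finfun (nth 0 s)). Qed.

Definition bar1 a : bar 'F_2 1 A := << word 1 [:: a] >>.
Definition bar2 a b : bar 'F_2 2 A := << word 2 [:: a; b] >>.
Definition bar3 a b c : bar 'F_2 3 A := << word 3 [:: a; b; c] >>.

Lemma bar2_d a b : bar_d (bar2 a b) = bar1 b + (bar1 (a + b) + bar1 a).
Proof.
have E0 : bar_face 0 (word 2 [:: a; b]) = word 1 [:: b].
  by apply: eq_entry => -[|//] _; rewrite entry_face // !entry_word.
have E1 : bar_face 1 (word 2 [:: a; b]) = word 1 [:: a + b].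
  by apply: eq_entry => -[|//] _; rewrite entry_face // !entry_word.
have E2 : bar_face 2 (word 2 [:: a; b]) = word 1 [:: a].
  by apply: eq_entry => -[|//] _; rewrite entry_face // !entry_word.
by rewrite bar_dU_F2 big_nat_recl // big_nat_recl // big_nat1 E0 E1 E2.
Qed.

Lemma bar3_d a b c : bar_d (bar3 a b c)
  = bar2 b c + (bar2 (a + b) c + (bar2 a (b + c) + bar2 a b)).
Proof.
have E0 : bar_face 0 (word 3 [:: a; b; c]) = word 2 [:: b; c].
  by apply: eq_entry => -[|[|//]] _; rewrite entry_face // !entry_word.
have E1 : bar_face 1 (word 3 [:: a; b; c]) = word 2 [:: a + b; c].
  by apply: eq_entry => -[|[|//]] _; rewrite entry_face // !entry_word.
have E2 : bar_face 2 (word 3 [:: a; b; c]) = word 2 [:: a; b + c].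
  by apply: eq_entry => -[|[|//]] _; rewrite entry_face // !entry_word.
have E3 : bar_face 3 (word 3 [:: a; b; c]) = word 2 [:: a; b].
  by apply: eq_entry => -[|[|//]] _; rewrite entry_face // !entry_word.
rewrite bar_dU_F2 big_nat_recl // big_nat_recl // big_nat_recl // big_nat1.
by rewrite E0 E1 E2 E3.
Qed.

(** When 2a = 0, the boundary of [a|a] is [0] and not zero; [0|0] has the same boundary and corrects
    it. *)
Definition square a := bar2 a a + bar2 0 0.

Lemma square_d a : a + a = 0 -> bar_d (square a) = 0.
Proof.
move=> aa; rewrite linearD /= !bar2_d aa addr0.
by rewrite (addrCA (bar1 a)) !addrr_F2.
Qed.

(** This cycle is the shuffle product of [a] and [b], the image of the torus class; its boundary
    cancels because a + b = b + a. *)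
Lemma commutator_d a b : bar_d (bar2 a b + bar2 b a) = 0.
Proof.
rewrite linearD /= !bar2_d (addrC b a).
by rewrite [bar1 b + _]addrA [bar1 b + _ + _]addrC [bar1 b + _]addrC addrr_F2.
Qed.

(* The class of [a|a] + [0|0] is the divided square of [a],
   whose deviation from additivity is the Pontryagin product of [a] and [b]. *)
Lemma squareD a b : a + a = 0 -> b + b = 0 ->
  square (a + b) = square a + square b + (bar2 a b + bar2 b a)
    + bar_d (bar3 a b (a + b) + bar3 b b a + bar3 0 0 a).
Proof.
move=> aa bb; rewrite !linearD /=.
have bab : b + (a + b) = a by rewrite addrCA bb addr0.
rewrite (bar3_d a b) (bar3_d b b) (bar3_d 0 0) bab bb (addrC b a) !(add0r, addr0).
(* After expansion every symbol occurs an even number of times; the permutation below arranges the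
   twenty terms into ten equal pairs. *)
have cancel (V : lmodType 'F_2) (p q r s u v w x : V) :
  x + w = v + w + (u + w) + (s + r) + (q + (x + (v + s)) + (r + (p + (q + u)))
          + (p + (p + (p + w)))).
  apply/eqP; rewrite -subr_eq0 opprF2 !addrA.
  rewrite (ACl ((1 * 10) * (2 * 4) * (6 * 20) * (3 * 11) * (5 * 16) * (7 * 12)
                * (8 * 13) * (9 * 15) * (14 * 17) * (18 * 19))) /=.
  by rewrite !addrr_F2.
exact: (cancel (bar 'F_2 2 A)).
Qed.

End LowDegree.

(** * Homology classes and their stabilization *)

Lemma cup_eq0 (A : zmodType) n (psi : nat -> A -> 'F_2) j (c : bar 'F_2 n A) :
  (j < n)%N -> psi j =1 (fun=> 0) -> cup psi c = 0.
Proof.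
move=> lt_jn psi0; apply: (@malg_linear_ind _ _ _ (@cup _ n psi) \0) => a /=.
rewrite cupU (big_cat_nat (n := j)) //=; last exact: ltnW.
by rewrite [X in _ * X]big_ltn // psi0 mul0r mulr0.
Qed.

Lemma cup_bar2 (A : zmodType) (psi : nat -> A -> 'F_2) a b :
  cup psi (bar2 a b) = psi 0 a * psi 1 b.
Proof. by rewrite cupU big_ltn // big_nat1 !entry_word. Qed.

Lemma bar_map_bar2 (A B : zmodType) (f : {additive A -> B}) a b :
  bar_map f (bar2 a b) = bar2 (f a) (f b).
Proof.
rewrite /bar2 bar_mapU; congr << _ >>; apply: eq_entry => k lt_k2.
rewrite entry_map !entry_word //.
by case: k lt_k2 => [|[]].
Qed.

Lemma bar_map_square (A B : zmodType) (f : {additive A -> B}) a :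
  bar_map f (square a) = square (f a).
Proof. by rewrite linearD /= !bar_map_bar2 raddf0. Qed.

Section HomologyClass.
Variables (n : nat) (A : zmodType).

Lemma bar_cycleP (c : bar 'F_2 n.+1 A) :
  bar_d c = 0 -> c \in @bar_cycle 'F_2 n.+1 A.
Proof. by move/eqP. Qed.

Definition homology_class (c : bar 'F_2 n.+1 A) (dc : bar_d c = 0) :
  homology 'F_2 n.+1 A := \pi_(homology 'F_2 n.+1 A) (Sub c (bar_cycleP dc)).

Lemma homology_class_homologous (c c' : bar 'F_2 n.+1 A) dc dc' b :
  c = c' + bar_d b -> @homology_class c dc = @homology_class c' dc'.
Proof.
move=> E; apply/eqP; rewrite -Quotient.idealrBE; apply/asboolP; exists b.
by rewrite -[RHS]/(c - c') E [RHS]addrC addKr.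
Qed.

Lemma bar_d_eq0D (c c' : bar 'F_2 n.+1 A) :
  bar_d c = 0 -> bar_d c' = 0 -> bar_d (c + c') = 0.
Proof. by move=> dc dc'; rewrite linearD /= dc dc' addr0. Qed.

Lemma homology_classD (c c' : bar 'F_2 n.+1 A) dc dc' :
  @homology_class c dc + @homology_class c' dc' = homology_class (bar_d_eq0D dc dc').
Proof. by rewrite -raddfD; congr (\pi_(_) _); apply: val_inj. Qed.

Variable psi : nat -> A -> 'F_2.

Definition homology_cup (x : homology 'F_2 n.+1 A) : 'F_2 := cup psi (val (repr x)).

Hypothesis psiD : forall k, {morph psi k : x y / x + y}.

(** Two representatives differ by a boundary, on which a product of additive functions vanishes. *)
Lemma homology_cup_pi z :
  homology_cup (\pi_(homology 'F_2 n.+1 A) z) = cup psi (val z).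
Proof.
have /asboolP[b bz] :
    repr (\pi_(homology 'F_2 n.+1 A) z) - z \in @bar_boundary _ n.+1 A.
  by rewrite Quotient.idealrBE reprK.
have := cup_boundary b (fun k _ => psiD k); rewrite bz.
rewrite -[val _]/(val (repr (\pi_(homology 'F_2 n.+1 A) z)) - val z) linearB.
by move/eqP; rewrite subr_eq0 => /eqP.
Qed.

Lemma homology_cupD x y : homology_cup (x + y) = homology_cup x + homology_cup y.
Proof.
elim/homologyW: x => x; elim/homologyW: y => y.
by rewrite -raddfD !homology_cup_pi -[val (x + y)]/(val x + val y) linearD.
Qed.

End HomologyClass.

Definition mk_additive (A B : zmodType) (f : A -> B) (fB : zmod_morphism f) :
  {additive A -> B} := HB.pack f (GRing.isZmodMorphism.Build A B f fB).

Section Stabilization.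
Variable m : nat.

(* The product of the generators of Z^m in H_m(Z^m) shifts degree by m. *)
Definition stab (A : zmodType) : zmodType := (A * {ffun 'I_m -> int})%type.

Lemma stab_map_zmod (A B : zmodType) (f : {additive A -> B}) :
  zmod_morphism ((fun x => (f x.1, x.2)) : stab A -> stab B).
Proof. by move=> x y; rewrite raddfB. Qed.

Definition stab_map (A B : zmodType) (f : {additive A -> B}) :
  {additive stab A -> stab B} := mk_additive (stab_map_zmod f).

Section Suspension.
Variable A : zmodType.

Definition gen (j : nat) : stab A := (0, [ffun i : 'I_m => (i == j :> nat)%:Z]).

(** Iterated shuffle product with [gen 0], ..., [gen j.-1]. Degrees 2 and 3 have separate versions
    so that the resulting degree is literally [j.+2] or [j.+3]. *)
Fixpoint suspend2 j (c : bar 'F_2 2 (stab A)) : bar 'F_2 j.+2 (stab A) :=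
  if j is i.+1 then suspend (gen i) (suspend2 i c) else c.

Fixpoint suspend3 j (c : bar 'F_2 3 (stab A)) : bar 'F_2 j.+3 (stab A) :=
  if j is i.+1 then suspend (gen i) (suspend3 i c) else c.

Lemma suspend2D j c c' : suspend2 j (c + c') = suspend2 j c + suspend2 j c'.
Proof. by elim: j => //= j ->; rewrite linearD. Qed.

Lemma suspend2_d j c : bar_d c = 0 -> bar_d (suspend2 j c) = 0.
Proof. by move=> dc; elim: j => //= j IHj; rewrite bar_d_suspend IHj linear0. Qed.

Lemma suspend3_d j c : bar_d (suspend3 j c) = suspend2 j (bar_d c).
Proof. by elim: j => //= j IHj; rewrite bar_d_suspend IHj. Qed.

(** Suspension by [gen i] starts in degree [i.+2], so the new last factor [psi i.+2] is the one that
    detects it. *)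
Lemma cup_suspend2 (psi : nat -> stab A -> 'F_2) j c :
  (forall i k, (i < m)%N -> (k < i.+3)%N -> psi k (gen i) = (k == i.+2)%:R) ->
  (j <= m)%N -> cup psi (suspend2 j c) = cup psi c.
Proof.
move=> psiE; elim: j => //= j IHj lt_jm; rewrite cup_suspend ?IHj 1?ltnW //.
- by move=> k lt_kj; rewrite (psiE _ _ lt_jm (ltnW lt_kj)) ltn_eqF.
- by rewrite psiE // eqxx.
Qed.

End Suspension.

Lemma bar_map_suspend2 (A B : zmodType) (f : {additive A -> B}) j c :
  bar_map (stab_map f) (suspend2 j c) = suspend2 j (bar_map (stab_map f) c).
Proof.
have genE i : stab_map f (gen A i) = gen B i by rewrite /gen /= raddf0.
by elim: j => //= j IHj; rewrite bar_map_suspend IHj genE.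
Qed.

End Stabilization.

(** * Transport along a factorization of homology *)

(** Conjugating [Phi] by the isomorphism lets every morphism [T X -> T Y] act on [H], including
    those that come from no morphism [X -> Y]. *)
Lemma nat_iso_conjugate (B C D : category) (T : functor B C) (Phi : functor C D)
    (H : functor B D) : nat_iso (functor_comp Phi T) H ->
  exists Psi : forall X Y : B, hom (T X) (T Y) -> hom (H X) (H Y),
    (forall X Y (f : hom X Y), Psi X Y (fmor T f) = fmor H f) /\
    (forall X Y Z (g : hom (T Y) (T Z)) (f : hom (T X) (T Y)),
       Psi X Z (compm g f) = compm (Psi Y Z g) (Psi X Y f)).
Proof.
move=> [eta [etaN eta_iso]].
pose inv X := sval (cid (eta_iso X)).
have invK X : compm (inv X) (eta X) = idm _ by rewrite /inv; case: cid => ? [].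
have etaK X : compm (eta X) (inv X) = idm _ by rewrite /inv; case: cid => ? [].
exists (fun X Y x => compm (compm (eta Y) (fmor Phi x)) (inv X)); split.
  by move=> X Y f; rewrite (etaN X Y f) -compmA etaK compm1.
move=> X Y Z g f; rewrite fmor_comp -!compmA; congr (compm _ (compm _ _)).
by rewrite compmA invK comp1m.
Qed.

(** * Finite generation of the groups in the argument *)

Lemma fin_gen_int : fin_gen int.
Proof.
exists 1%N, (fun=> 1) => a; exists (fun=> a).
by rewrite big_ord1 intz.
Qed.

Lemma fin_gen_F2 : fin_gen 'F_2.
Proof.
exists 1%N, (fun=> 1) => a; exists (fun=> (a : nat)%:Z).
by rewrite big_ord1 -pmulrn natr_Zp.
Qed.

Lemma fin_gen_prod (A B : zmodType) :
  fin_gen A -> fin_gen B -> fin_gen (A * B)%type.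
Proof.
move=> [k [s sA]] [l [r rB]].
exists (k + l)%N.
exists (fun i => match split i with inl j => (s j, 0) | inr j => (0, r j) end).
move=> [a b]; have [c ->] := sA a; have [d ->] := rB b.
exists (fun i => match split i with inl j => c j | inr j => d j end).
have splitl (i : 'I_k) : split (lshift l i) = inl i by exact: (unsplitK (inl i)).
have splitr (i : 'I_l) : split (rshift k i) = inr i by exact: (unsplitK (inr i)).
rewrite big_split_ord; apply/eqP; rewrite xpair_eqE.
rewrite !(raddfD fst, raddfD snd, raddf_sum fst, raddf_sum snd) /=.
apply/andP; split; apply/eqP.
- rewrite [X in _ + X]big1 ?addr0 => [|i _]; last first.
    by rewrite splitr (raddfMz fst) mul0rz.
  by apply: eq_bigr => i _; rewrite splitl (raddfMz fst).
- rewrite [X in X + _]big1 ?add0r => [|i _]; last first.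
    by rewrite splitl (raddfMz snd) mul0rz.
  by apply: eq_bigr => i _; rewrite splitr (raddfMz snd).
Qed.

Lemma fin_gen_ffun (m : nat) : fin_gen {ffun 'I_m -> int}.
Proof.
exists m, (fun i => [ffun j => (i == j)%:Z]) => a; exists a.
apply/ffunP => j; rewrite sum_ffunE (bigD1 j) //= big1 => [|i ij].
  by rewrite addr0 ffunMzE ffunE eqxx intz.
by rewrite ffunMzE ffunE (negPf ij) mul0rz.
Qed.

(** * Linear maps on A/2 from functions that are additive only modulo 2 *)

Section Mod2Section.
Variables (A B : zmodType) (s : A -> B).
Hypothesis sB : forall x y,
  \pi_(mod2 B) (s (x - y)) = \pi_(mod2 B) (s x) - \pi_(mod2 B) (s y).

Definition mod2_descend (x : mod2 A) : mod2 B := \pi_(mod2 B) (s (repr x)).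

(** Writing 2b as b - (0 - b) shows that [s] sends it to twice the class of [s b], which is zero in
    B/2. *)
Lemma mod2_descend_pi a : mod2_descend (\pi_(mod2 A) a) = \pi_(mod2 B) (s a).
Proof.
have /asboolP[b ab] : repr (\pi_(mod2 A) a) - a \in @doubles A.
  by rewrite Quotient.idealrBE reprK.
apply/eqP; rewrite -subr_eq0 -sB ab.
have s0 : \pi_(mod2 B) (s 0) = 0 by rewrite -(subrr 0) sB subrr.
have -> : b *+ 2 = b - (0 - b) by rewrite sub0r opprK.
by rewrite !sB s0 sub0r opprK -mulr2n mod2_mul2n.
Qed.

Lemma mod2_descend_zmod : zmod_morphism mod2_descend.
Proof.
by elim/quotW=> x; elim/quotW=> y; rewrite -raddfB !mod2_descend_pi sB.
Qed.
HB.instance Definition _ :=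
  GRing.isZmodMorphism.Build _ _ mod2_descend mod2_descend_zmod.
HB.instance Definition _ := GRing.isScalable.Build 'F_2 (mod2 A) (mod2 B) *:%R
  mod2_descend (additive_scalable mod2_descend).

Definition mod2_lift : {linear mod2 A -> mod2 B} := mod2_descend.

End Mod2Section.

(** * The contradiction *)

Lemma diag_zmod : zmod_morphism ((fun a => (a, a)) : 'F_2 -> 'F_2 * 'F_2).
Proof. by []. Qed.

Lemma inj1_zmod : zmod_morphism ((fun a => (a, 0)) : 'F_2 -> 'F_2 * 'F_2).
Proof. by move=> a b; congr (_, _); rewrite subrr. Qed.

Lemma inj2_zmod : zmod_morphism ((fun a => (0, a)) : 'F_2 -> 'F_2 * 'F_2).
Proof. by move=> a b; congr (_, _); rewrite subrr. Qed.

Lemma sum_zmod : zmod_morphism ((fun x => x.1%:~R + x.2) : int * 'F_2 -> 'F_2).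
Proof. by move=> x y /=; rewrite rmorphB /= opprD addrACA. Qed.

Lemma red_zmod :
  zmod_morphism ((fun x => (x.1%:~R, x.2%:~R)) : int * int -> 'F_2 * 'F_2).
Proof. by move=> x y /=; rewrite !rmorphB. Qed.

Section Argument.
Variable m : nat.

Notation stab := (stab m).
Notation F2 := ('F_2 : zmodType).
Notation F22 := ('F_2 * 'F_2 : zmodType)%type.
Notation ZF2 := (int * 'F_2 : zmodType)%type.
Notation ZZ := (int * int : zmodType)%type.

Definition diag := stab_map m (mk_additive diag_zmod).
Definition inj1 := stab_map m (mk_additive inj1_zmod).
Definition inj2 := stab_map m (mk_additive inj2_zmod).
Definition sum_map := stab_map m (mk_additive sum_zmod).
Definition snd_map := stab_map m (snd : {additive ZF2 -> F2}).
Definition red := stab_map m (mk_additive red_zmod).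
(** The stabilized form of the zero homomorphism: it is still the identity on Z^m. *)
Definition proj (A B : zmodType) := stab_map m (\0 : {additive A -> B}).

(** In degree [m.+2] the cup product of these functions is x_1 x_2 times the product of the
    coordinates of Z^m modulo 2. *)
Definition coord (k : nat) (x : stab F22) : 'F_2 :=
  match k with
  | 0 => x.1.1
  | 1 => x.1.2
  | i.+2 => (entry x.2 i)%:~R
  end.

Lemma coordD k : {morph coord k : x y / x + y}.
Proof.
case: k => [|[|k]] //= x y; rewrite -rmorphD; congr (_%:~R).
rewrite /entry; case: insubP => [i _ _|_] /=; last by rewrite addr0.
by rewrite ffunE.
Qed.

Lemma coord_gen i k : (i < m)%N -> (k < i.+3)%N ->
  coord k (gen m F22 i) = (k == i.+2)%:R.
Proof.
move=> lt_im; case: k => [|[|k]] //=; rewrite !ltnS => le_ki.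
have lt_km : (k < m)%N by exact: leq_ltn_trans lt_im.
by rewrite (entry_finfun (fun j => (j == i)%:Z)) // !eqSS.
Qed.

Lemma cup_diag_suspend2 a :
  cup coord (suspend2 m (square ((a, 0) : stab F22))) = a.1 * a.2.
Proof.
rewrite (cup_suspend2 _ coord_gen) // linearD /= !cup_bar2 /=.
by rewrite mul0r addr0.
Qed.

Definition choose2 (k : int) : int := ((k * (k - 1)) %/ 2)%Z.

(** The coboundary of [choose2] is the product [k * l]; modulo 2 this is why x^2 vanishes on Z. *)
Lemma choose2D k l :
  choose2 (k + l) = choose2 k + choose2 l + k * l.
Proof.
have E x : choose2 x * 2 = x * (x - 1).
  rewrite /choose2 divzK // (divz_eq x 2).
  have /orP[/eqP->|/eqP->] : ((x %% 2)%Z == 0) || ((x %% 2)%Z == 1) by lia.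
    by rewrite addr0 -mulrA dvdz_mull // dvdz_mulr.
  by rewrite addrK mulrA dvdz_mull.
have := E k; have := E l; have := E (k + l).
move: (choose2 _) (choose2 _) (choose2 _) => p q r.
nia.
Qed.

Lemma sum_snd_cohomologous (c : bar 'F_2 m.+2 (stab ZF2)) : bar_d c = 0 ->
  cup coord (bar_map diag (bar_map sum_map c))
  = cup coord (bar_map diag (bar_map snd_map c)).
Proof.
have cupE (g : {additive stab ZF2 -> stab F2}) :
    cup coord (bar_map diag (bar_map g c)) = cup (fun k => coord k \o (diag \o g)) c.
  exact: etrans (congr1 (cup coord) (esym (bar_map_comp diag g c))) (cup_map _ _ _).
move=> dc; apply: etrans (cupE sum_map) (etrans _ (esym (cupE snd_map))).
(* With k and a the coordinates of Z x Z/2, the difference of the squares of k + a and a is kk + ka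
   + ak as cochains. [choose2] cobounds kk, and the function k a cobounds ka + ak. *)
move: dc; pose beta (x : stab ZF2) : 'F_2 := (choose2 x.1.1)%:~R + x.1.1%:~R * x.1.2.
apply: (@cup_cohomologous _ _ _ _ beta).
- move=> x y /=; rewrite /beta /= choose2D !rmorphD /= rmorphM /=.
  set k := x.1.1%:~R; set l := y.1.1%:~R; set a := x.1.2; set b := y.1.2.
  set p := (choose2 x.1.1)%:~R; set q := (choose2 y.1.1)%:~R.
  pose r : 'F_2 := p + q + k * a + l * b - a * b.
  (* [ring] does not know that 2 = 0; the two sides differ by [r + r]. *)
  rewrite -[LHS]addr0 -[X in _ + X](addrr_F2 (r : ('F_2)^o)).
  by rewrite -[_ + (r + r)]/((_ : 'F_2) + (r + r)) /r; ring.
- by move=> [|[|k]].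
- move=> k _ x y.
  exact: etrans (congr1 (coord k) (raddfD (diag \o sum_map) x y)) (coordD _ _ _).
Qed.

Lemma homology_cup_sum_snd (y : homology 'F_2 m.+2 (stab ZF2)) :
  homology_cup coord (homology_map diag (homology_map sum_map y))
  = homology_cup coord (homology_map diag (homology_map snd_map y)).
Proof.
elim/homologyW: y => z.
have cupE (g : {additive stab ZF2 -> stab F2}) :
    homology_cup coord (homology_map diag (homology_map g (\pi_(homology _ _ _) z)))
    = cup coord (bar_map diag (bar_map g (val z))).
  by rewrite !homology_map_pi (homology_cup_pi coordD).
have dz : bar_d (val z) = 0 by exact: (eqP (valP z)).
by rewrite (cupE sum_map) (sum_snd_cohomologous dz) cupE.
Qed.

Lemma homology_cup_map_eq0 (A : zmodType) (f : {additive stab A -> stab F22}) j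
    (x : homology 'F_2 m.+2 (stab A)) :
  (j < m.+2)%N -> coord j \o f =1 (fun=> 0) ->
  homology_cup coord (homology_map f x) = 0.
Proof.
move=> lt_jm f0; elim/homologyW: x => z.
rewrite homology_map_pi (homology_cup_pi coordD) /= cup_map.
exact: cup_eq0 lt_jm f0.
Qed.

Lemma suspend2_squareD (A : zmodType) (a b : stab A) :
  a + a = 0 -> b + b = 0 ->
  suspend2 m (square (a + b))
  = suspend2 m (square a) + suspend2 m (square b) + suspend2 m (bar2 a b + bar2 b a)
    + bar_d (suspend3 m (bar3 a b (a + b) + bar3 b b a + bar3 0 0 a)).
Proof.
move=> aa bb; rewrite (squareD aa bb) suspend3_d.
move: (square a) (square b) (bar2 a b + _) (bar_d _) => x y z t.
by rewrite !suspend2D.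
Qed.

Section Contradiction.
Variables (C : category) (T : functor AbFg C) (Phi : functor C Vect).

Definition stab_fg (A : zmodType) (fgA : fin_gen A) : AbFg :=
  exist fin_gen (stab A) (fin_gen_prod fgA (fin_gen_ffun m)).

Let XF2 := stab_fg fin_gen_F2.
Let XF22 := stab_fg (fin_gen_prod fin_gen_F2 fin_gen_F2).
Let XZF2 := stab_fg (fin_gen_prod fin_gen_int fin_gen_F2).
Let XZZ := stab_fg (fin_gen_prod fin_gen_int fin_gen_int).

Variables (v : hom (T XF2) (T XZF2)) (w : hom (T XF2) (T XF2))
          (w2 : hom (T XF22) (T XF22)).

Hypothesis sum_v : compm (fmor T (sum_map : hom XZF2 XF2)) v = idm (T XF2).
Hypothesis snd_v : compm (fmor T (snd_map : hom XZF2 XF2)) v = w.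
Hypothesis diag_w :
  compm (fmor T (diag : hom XF2 XF22)) w = compm w2 (fmor T (diag : hom XF2 XF22)).
Hypothesis inj1_w :
  compm (fmor T (inj1 : hom XF2 XF22)) w = compm w2 (fmor T (inj1 : hom XF2 XF22)).
Hypothesis inj2_w :
  compm (fmor T (inj2 : hom XF2 XF22)) w = compm w2 (fmor T (inj2 : hom XF2 XF22)).
Hypothesis red_w :
  compm w2 (fmor T (red : hom XZZ XF22)) = fmor T (proj ZZ F22 : hom XZZ XF22).

(** [C] and [T] are abstract so that one argument serves all groups and finitely generated ones. [v]
    is the inclusion not induced by a homomorphism; [w] and [w2] are the idempotents for Z/2 and its
    square. *)
Lemma homology_not_factor :
  ~ nat_iso (functor_comp Phi T)
      (functor_comp (group_homology 'F_2 m.+2) (inclusion (C := Ab) fin_gen)).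
Proof.
move=> /nat_iso_conjugate[Psi [PsiT PsiM]].
have PsiTE X Y (g : hom X Y) x : Psi X Y (fmor T g) x = homology_map g x.
  by rewrite PsiT.
have PsiME X Y Z (g : hom (T Y) (T Z)) (h : hom (T X) (T Y)) x :
    Psi X Z (compm g h) x = Psi Y Z g (Psi X Y h x).
  by rewrite PsiM.
pose u : stab F2 := (1, 0).
pose a : stab F22 := ((1, 0), 0).
pose b : stab F22 := ((0, 1), 0).
pose e : stab ZZ := ((1, 0), 0).
pose f : stab ZZ := ((0, 1), 0).
have uu : u + u = 0 by congr (_, _); [apply: val_inj | rewrite addr0].
have aa : a + a = 0.
  by congr (_, _); [congr (_, _); apply: val_inj | rewrite addr0].
have bb : b + b = 0.
  by congr (_, _); [congr (_, _); apply: val_inj | rewrite addr0].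
(* [zeta] is the generator z of H_2(Z/2), and [omega] the torus class in H_2(Z^2), each multiplied
   by the class of Z^m. *)
pose zeta : homology 'F_2 m.+2 (stab F2) :=
  homology_class (suspend2_d m (square_d uu)).
pose omega : homology 'F_2 m.+2 (stab ZZ) :=
  homology_class (suspend2_d m (commutator_d e f)).
pose c := @homology_cup m.+1 (stab F22) coord.
have c_diag : c (homology_map diag zeta) = 1.
  rewrite homology_map_pi /c (homology_cup_pi coordD) /=.
  rewrite bar_map_suspend2 bar_map_square.
  by rewrite -[mk_additive _ u]/((1, 1), 0) cup_diag_suspend2 mulr1.
have ab : (a + b) + (a + b) = 0.
  by rewrite addrACA aa bb; exact: addr0.
have diag_u : diag u = a + b.
  by congr ((_, _), _); rewrite ?addr0 ?add0r.
have red_e : red e = a by [].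
have red_f : red f = b by [].
have classE (g : {additive stab F2 -> stab F22}) z (zz : z + z = 0) :
    bar_map g (suspend2 m (square u)) = suspend2 m (square z) ->
    homology_map g zeta = homology_class (suspend2_d m (square_d zz)).
  by move=> gE; rewrite homology_map_pi; congr (\pi_(_) _); apply: val_inj.
(* This is D z = i_1 z + i_2 z + r with r the image of [omega]: the suspended form of [squareD] for
   [diag u = a + b]. *)
have diagE : homology_map diag zeta
    = homology_map inj1 zeta + homology_map inj2 zeta + homology_map red omega.
  have redE : homology_map red omega
      = homology_class (suspend2_d m (commutator_d a b)).
    rewrite homology_map_pi; congr (\pi_(_) _); apply: val_inj.
    by rewrite /= bar_map_suspend2 linearD /= !bar_map_bar2 red_e red_f.
  rewrite redE.
  rewrite (classE diag _ ab); last by rewrite bar_map_suspend2 bar_map_square diag_u.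
  rewrite (classE inj1 _ aa); last by rewrite bar_map_suspend2 bar_map_square.
  rewrite (classE inj2 _ bb); last by rewrite bar_map_suspend2 bar_map_square.
  rewrite !homology_classD.
  apply: (@homology_class_homologous _ _ _ _ _ _
    (suspend3 m (bar3 a b (a + b) + bar3 b b a + bar3 0 0 a))).
  exact: suspend2_squareD.
have PsiI X x : Psi X X (idm (T X)) x = x.
  by rewrite -(fmor_id T) PsiT fmor_id.
pose y := Psi XF2 XZF2 v zeta.
have sum_y : homology_map sum_map y = zeta.
  by rewrite -(PsiTE XZF2 XF2 sum_map y) -PsiME sum_v PsiI.
have snd_y : homology_map snd_map y = Psi XF2 XF2 w zeta.
  by rewrite -(PsiTE XZF2 XF2 snd_map y) -PsiME snd_v.
have commute (g : hom XF2 XF22) :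
    compm (fmor T g) w = compm w2 (fmor T g) ->
    Psi XF22 XF22 w2 (homology_map g zeta)
    = homology_map g (Psi XF2 XF2 w zeta).
  by move=> gw; rewrite -(PsiTE XF2 XF22 g zeta) -PsiME -gw PsiME PsiTE.
(* Invariance of x^2 under w: w is the second projection after [v], the cup product does not
   distinguish that projection from the sum, and the sum after [v] is the identity. *)
have : c (Psi XF22 XF22 w2 (homology_map diag zeta)) = 1.
  rewrite (commute diag diag_w) -snd_y /c -homology_cup_sum_snd sum_y.
  exact: c_diag.
have zero1 : c (Psi XF22 XF22 w2 (homology_map inj1 zeta)) = 0.
  apply: etrans (congr1 c (commute inj1 inj1_w)) _.
  exact: (@homology_cup_map_eq0 _ inj1 1%N).
have zero2 : c (Psi XF22 XF22 w2 (homology_map inj2 zeta)) = 0.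
  (* The factor that vanishes is x_1 here, and x_2 for [inj1]. *)
  apply: etrans (congr1 c (commute inj2 inj2_w)) _.
  exact: (@homology_cup_map_eq0 _ inj2 0%N).
have zero3 : c (Psi XF22 XF22 w2 (homology_map red omega)) = 0.
  rewrite -(PsiTE XZZ XF22 red omega) -PsiME red_w PsiTE.
  exact: (@homology_cup_map_eq0 _ (proj ZZ F22) 0%N).
rewrite diagE 2!raddfD /c 2!(homology_cupD coordD) => sum1.
have : c (Psi XF22 XF22 w2 (homology_map inj1 zeta))
  + c (Psi XF22 XF22 w2 (homology_map inj2 zeta))
  + c (Psi XF22 XF22 w2 (homology_map red omega)) = 1 by exact: sum1.
by rewrite zero1 zero2 zero3.
Qed.

End Contradiction.

End Argument.

(** * Morphisms of pairs not induced by homomorphisms *)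

Section VirtualMorphisms.
Variable m : nat.

Notation stab := (stab m).
Notation F2 := ('F_2 : zmodType).
Notation F22 := ('F_2 * 'F_2 : zmodType)%type.
Notation ZF2 := (int * 'F_2 : zmodType)%type.
Notation ZZ := (int * int : zmodType)%type.

Definition lift_sect (x : stab F2) : stab ZF2 := (((x.1 : nat)%:Z, 0), x.2).

(** Lifting residues to 0 and 1 in Z fails to respect subtraction only for 0 - 1, where the error is
    2. *)
Lemma lift_sectB x y :
  \pi_(mod2 (stab ZF2)) (lift_sect (x - y))
  = \pi_(mod2 (stab ZF2)) (lift_sect x) - \pi_(mod2 (stab ZF2)) (lift_sect y).
Proof.
rewrite -raddfB; apply/eqP; rewrite -Quotient.idealrBE; apply/asboolP.
have [k kE] : exists k : int,
    ((x - y).1 : nat)%:Z - ((x.1 : nat)%:Z - (y.1 : nat)%:Z) = k *+ 2.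
  case: x y => [[[|[|//]] ?] u] [[[|[|//]] ?] u'] /=.
  - by exists 0.
  - by exists 1.
  - by exists 0.
  - by exists 0.
exists ((k, 0), 0).
rewrite -[((k, 0), 0) *+ 2]/((k *+ 2, 0 *+ 2), 0 *+ 2) !mul0rn -kE.
by congr ((_, _), _); [apply: val_inj | apply: subrr].
Qed.

Lemma incl2_zmod : zmod_morphism ((fun a => (0, a)) : 'F_2 -> int * 'F_2).
Proof. by move=> a b; congr (_, _). Qed.

Definition incl2 := stab_map m (mk_additive incl2_zmod).

(* On A/2 this is the inclusion of Z/2 as (Z/2, 0), on the 2-torsion as (0, Z/2). *)
Definition twisted_incl : @hom Vect2 (t (stab F2)) (t (stab ZF2)) :=
  (mod2_lift lift_sectB, (torsion2_map incl2 : {linear _ -> _})).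

(** The idempotent w for any [A]: on reductions modulo 2, [proj] kills A/2 but keeps the part from
    Z^m. *)
Definition kill_mod2 (A : zmodType) : @hom Vect2 (t (stab A)) (t (stab A)) :=
  ((mod2_map (proj m A A) : {linear _ -> _}), @idm Vect (torsion2 (stab A))).

(** Reductions enter through the Z coordinate and torsion through the Z/2 coordinate. The sum
    recovers both, whereas the second projection loses the former. *)
Lemma sum_twisted_incl :
  compm (fmor t (sum_map m : @hom Ab _ _)) twisted_incl = idm (t (stab F2)).
Proof.
congr (_, _); apply: linear_ext.
  elim/quotW=> x.
  rewrite /= (mod2_descend_pi lift_sectB) mod2_map_pi; congr (\pi_(_) _).
  by case: x => a u; congr (_, _); rewrite /= addr0 -pmulrn natr_Zp.
case=> -[a u] au; apply: val_inj; congr (_, _).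
exact: add0r.
Qed.

Lemma snd_twisted_incl :
  compm (fmor t (snd_map m : @hom Ab _ _)) twisted_incl = kill_mod2 F2.
Proof.
congr (_, _); apply: linear_ext.
  elim/quotW=> x.
  by rewrite /= (mod2_descend_pi lift_sectB) !mod2_map_pi; congr (\pi_(_) _).
by case=> -[a u] au; apply: val_inj.
Qed.

Lemma stab_map_kill_mod2 (A B : zmodType) (f : {additive A -> B}) :
  compm (fmor t (stab_map m f : @hom Ab _ _)) (kill_mod2 A)
  = compm (kill_mod2 B) (fmor t (stab_map m f : @hom Ab _ _)).
Proof.
congr (_, _); apply: linear_ext; last by move=> x; apply: val_inj.
elim/quotW=> x; rewrite /= !mod2_map_pi; congr (\pi_(_) _).
by congr (_, _); rewrite /= raddf0.
Qed.

(** Z^2 x Z^m has no 2-torsion, so only the reductions modulo 2 matter, and there w kills the image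
    of Z^2. *)
Lemma red_kill_mod2 :
  compm (kill_mod2 F22) (fmor t (red m : @hom Ab _ _))
  = fmor t (proj m ZZ F22 : @hom Ab _ _).
Proof.
congr (_, _); apply: linear_ext.
  elim/quotW=> x; rewrite /= (mod2_map_pi (red m)) !mod2_map_pi.
  by congr (\pi_(_) _).
have int_double0 (k : int) : k *+ 2 = 0 -> k = 0 by lia.
move=> x; have -> : x = 0; last by rewrite !linear0.
apply: val_inj; case: x => -[[k l] u] /= /eqP klu.
congr ((_, _), _); try apply: int_double0.
- exact: (congr1 (fun z => z.1.1) klu).
- exact: (congr1 (fun z => z.1.2) klu).
apply/ffunP => i; rewrite ffunE; apply: int_double0; rewrite -ffunMnE.
have u0 : u *+ 2 = 0 by exact: (congr1 snd klu).
by rewrite u0 ffunE.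
Qed.

End VirtualMorphisms.

Lemma nat_iso_restrict (B C D E : category) (I : functor B C) (T : functor C D)
    (Phi : functor D E) (H : functor C E) :
  nat_iso (functor_comp Phi T) H ->
  nat_iso (functor_comp Phi (functor_comp T I)) (functor_comp H I).
Proof.
move=> [eta [etaN eta_iso]]; exists (fun X => eta (I X)); split=> [X Y f|X].
  exact: etaN.
exact: eta_iso.
Qed.

Theorem proposition5p1 (n : nat) (hn : (2 <= n)%N) :
  ~ (exists Phi : functor Vect2 Vect,
       nat_iso (functor_comp Phi t) (group_homology 'F_2 n)) /\
  ~ (exists Phi : functor VectFd2 VectFd,
       nat_iso
         (functor_comp (inclusion (C := Vect) fin_dim) (functor_comp Phi t_fg))
         (functor_comp (group_homology 'F_2 n) (inclusion (C := Ab) fin_gen))).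
Proof.
case: n hn => [|[|m]] // _; split=> -[Phi iso].
  (* A factorization on all abelian groups restricts to the finitely generated ones. *)
  refine (@homology_not_factor m _
            (functor_comp t (inclusion (C := Ab) fin_gen)) Phi
            (twisted_incl m) (kill_mod2 m _) (kill_mod2 m _) _ _ _ _ _ _ _).
  - exact: sum_twisted_incl.
  - exact: snd_twisted_incl.
  - exact: stab_map_kill_mod2.
  - exact: stab_map_kill_mod2.
  - exact: stab_map_kill_mod2.
  - exact: red_kill_mod2.
  exact: (nat_iso_restrict (inclusion (C := Ab) fin_gen) iso).
(* [Phi] is followed by the inclusion into [Vect]; the morphisms of pairs and their relations are
   the same as before. *)
refine (@homology_not_factor m _ t_fg
          (functor_comp (inclusion (C := Vect) fin_dim) Phi)
          (twisted_incl m) (kill_mod2 m _) (kill_mod2 m _) _ _ _ _ _ _ _).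
- exact: sum_twisted_incl.
- exact: snd_twisted_incl.
- exact: stab_map_kill_mod2.
- exact: stab_map_kill_mod2.
- exact: stab_map_kill_mod2.
- exact: red_kill_mod2.
by case: iso => eta etaP; exists eta.
Qed.
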